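(* Let $n_1,\ldots,n_s$ be distinct positive integers and $r_1,\ldots,r_s$ positive integers, and let $G=K_{r_1.n_1,\ldots,r_s.n_s}$, with $k=\sum_i r_i$ and $n=\sum_i r_in_i$. Put $\sigma_0=1$, $\sigma_i=\sum_{1\leq j_1<\cdots<j_i\leq s} n_{j_1}\cdots n_{j_i}$ for $i=1,\ldots,s$; and for $l=1,\ldots,s$ put $\sigma_{l0}=0$, $\sigma_{l1}=n_l$, and $\sigma_{li}=\sum_{1\leq j_1<\cdots<j_{i-1}\leq s,\ j_1,\ldots,j_{i-1}\neq l} n_ln_{j_1}\cdots n_{j_{i-1}}$ for $i=2,\ldots,s$. Then $$S_G(\lambda)=(\lambda +1)^{n-k} \prod_{i=1}^{s}(\lambda+1-2n_i)^{r_i-1} \Big(\lambda^s+\sum_{m=1}^{s}\sum_{i=0}^{m}(-1)^{i-1}2^{i-1}\tbinom{s-i}{m-i}\Big(\sum_{l=1}^{s}r_l\sigma_{li}-2\sigma_i\Big)\lambda^{s-m}\Big).$$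
   Context: For a simple graph $G$ with adjacency matrix $A(G)$, the Seidel matrix is $S(G)=J-I-2A(G)$, where $I$ is the identity matrix and $J$ the all-ones matrix. The Seidel characteristic polynomial is $S_G(\lambda)=\det(\lambda I-S(G))$. $K_{r_1.n_1,\ldots,r_s.n_s}$ denotes the complete multipartite graph having exactly $r_i$ parts of size $n_i$ for each $i$; two vertices are adjacent iff they lie in different parts. *)

(* Defs.v *)
From HB Require Import structures.
From mathcomp Require Import all_boot all_order all_algebra.

Set Implicit Arguments.
Unset Strict Implicit.
Unset Printing Implicit Defensive.

Import Order.TTheory GRing.Theory Num.Theory.
Local Open Scope ring_scope.

Record sgraph := SGraph {
  vertex :> finType;
  edge : rel vertex;
  edge_sym : symmetric edge;
  edge_irrefl : irreflexive edge
}.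

(* Rows and columns are indexed by the vertices through [enum_val]. *)
Definition adjacency_mx (R : pzRingType) (G : sgraph) : 'M[R]_#|G| :=
  \matrix_(i, j) (edge (enum_val i) (enum_val j))%:R.

Definition seidel_mx (R : pzRingType) (G : sgraph) : 'M[R]_#|G| :=
  const_mx 1 - 1%:M - 2%:R *: adjacency_mx R G.

Definition seidel_poly (R : nzRingType) (G : sgraph) : {poly R} :=
  char_poly (seidel_mx R G).

(* G is the graph K_{r_1.n_1, ..., r_s.n_s}, up to isomorphism; P is the set of
   its parts, which are nonempty by the definition of [partition]. *)
Definition complete_multipartite (s : nat) (r n : 'I_s -> nat) (G : sgraph) :=
  exists P : {set {set G}},
    [/\ partition P [set: G],
        forall x y : G, edge x y = (pblock P x != pblock P y),
        forall B, B \in P -> exists i, #|B| = n i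
      & forall i, #|[set B in P | #|B| == n i]| = r i].

(* A choice of indices j_1 < ... < j_i is encoded as the set J of its elements;
   sigma n 0 = 1 is the contribution of the empty set. *)
Definition sigma (s : nat) (n : 'I_s -> nat) (i : nat) : nat :=
  (\sum_(J : {set 'I_s} | #|J| == i) \prod_(j in J) n j)%N.

Definition sigma_at (s : nat) (n : 'I_s -> nat) (l : 'I_s) (i : nat) : nat :=
  if i is i'.+1 then
    (\sum_(J : {set 'I_s} | (#|J| == i') && (l \notin J))
      n l * \prod_(j in J) n j)%N
  else 0%N.

(* Main.v *)
(** Write E for the vertex-part incidence matrix and t = X + 1.  The Seidel
    matrix is S = - I + E (2 I - J) E^T, hence X I - S = t I + E (J - 2 I) E^T,
    and exchanging the factors reduces its determinant to that of the small
    matrix t I + E^T E (J - 2 I).  Since E^T E is the diagonal matrix of the part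
    sizes d_b, this is a rank-one update of diag (t - 2 d_b), with determinant
    prod_b (t - 2 d_b) + sum_b d_b prod_(c != b) (t - 2 d_c).  Grouping equal
    part sizes factors out prod_i (t - 2 n_i)^(r_i - 1); the remaining factor is
    expanded in powers of t, whose coefficients are given by the sigmas, and
    then in powers of X by the binomial theorem. *)

Require Import Defs.
From HB Require Import structures.
From mathcomp Require Import all_boot all_order all_algebra.
From mathcomp Require Import ring.

Set Implicit Arguments.
Unset Strict Implicit.
Unset Printing Implicit Defensive.

Import Order.TTheory GRing.Theory Num.Theory.
Local Open Scope ring_scope.

(* A division-free form of det (A + U V) = det A det (1 + V A^-1 U), with U'
   standing for c A^-1 U; both sides are Schur complements in the block matrix
   with rows (A, - U) and (V, 1). *)
Lemma det_addM_exchange (R : comNzRingType) (p q : nat) (A : 'M[R]_p)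
    (U U' : 'M[R]_(p, q)) (V : 'M[R]_(q, p)) (c : R) :
  A *m U' = c *: U ->
  \det (A + U *m V) * c ^+ q = \det A * \det (c%:M + V *m U').
Proof.
move=> AU'.
have -> : \det (A + U *m V) = \det (block_mx A (- U) V 1%:M).
  have det1V : \det (block_mx 1%:M 0 (- V) 1%:M) = 1 :> R.
    by rewrite det_lblock !det1 mulr1.
  rewrite -[RHS]mulr1 -[X in _ = _ * X]det1V -det_mulmx mulmx_block.
  rewrite !mulmx1 mul1mx !mulmx0 subrr !add0r.
  by rewrite mulNmx mulmxN opprK det_ublock det1 mulr1.
(* Multiplying by this matrix on the right turns the upper right block into [A *m U' - c *: U],
   which vanishes by [AU']. *)
have <- : \det (block_mx 1%:M U' 0 c%:M) = c ^+ q.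
  by rewrite det_ublock det1 mul1r det_scalar.
rewrite -det_mulmx mulmx_block !mulmx1 !mulmx0 !addr0 mul1mx AU' mul_mx_scalar.
by rewrite scalerN subrr det_lblock addrC.
Qed.

(** Rank-one case of [det_addM_exchange], with [c] the determinant of the diagonal matrix: [U'] is
    then its adjugate applied to [u], and [c], a product of nonzero factors, cancels. *)
Lemma det_diag_addM_row (R : idomainType) (q : nat) (a u v : 'I_q -> R) :
  (forall i, a i != 0) ->
  \det (diag_mx (\row_i a i) + (\col_i u i) *m (\row_i v i))
    = \prod_i a i + \sum_i v i * u i * \prod_(j | j != i) a j.
Proof.
move=> a_neq0; set c := \prod_i a i.
have c_neq0 : c != 0 by apply/prodf_neq0 => i _; apply: a_neq0.
have := @det_addM_exchange R q 1 (diag_mx (\row_i a i)) (\col_i u i)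
  (\col_i (u i * \prod_(j | j != i) a j)) (\row_i v i) c.
rewrite expr1 det_diag => H; apply: (mulIf c_neq0); rewrite H; last first.
  apply/matrixP=> i j; rewrite mul_diag_mx !mxE /c [in RHS](bigD1 i) //=.
  by rewrite mulrCA mulrC.
rewrite mulrC; congr (_ * _); last by apply: eq_bigr => i _; rewrite mxE.
rewrite det_mx11 !mxE eqxx mulr1n; congr (_ + _).
by apply: eq_bigr => i _; rewrite !mxE mulrA.
Qed.

Lemma prod_addr_subset (R : comPzRingType) (I : finType) (A : {set I}) (t : R)
    (c : I -> R) :
  \prod_(j in A) (t + c j)
    = \sum_(J : {set I} | J \subset A) t ^+ (#|A| - #|J|) * \prod_(j in J) c j.
Proof.
rewrite big_mkcond /=.
(* Indices outside [A] get the summands 0 and 1, so in the distributed product a set [J] not inside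
   [A] contributes zero. *)
rewrite (eq_bigr (fun j => (if j \in A then c j else 0)
                           + (if j \in A then t else 1))); last first.
  by move=> j _; case: (j \in A); rewrite ?add0r // addrC.
rewrite bigA_distr [RHS]big_mkcond /=; apply: eq_bigr => J _.
case: ifPn => [sJA | /subsetPn[j jJ jA]]; last first.
  by rewrite (bigD1 j) //= jJ (negbTE jA) mul0r.
rewrite (bigID (mem J)) /= mulrC; congr (_ * _); last first.
  by apply: eq_bigr => j jJ; rewrite jJ (subsetP sJA).
rewrite (eq_bigr (fun j => if j \in A then t else 1)); last first.
  by move=> j /negbTE ->.
rewrite -big_mkcondr /= (eq_bigl (mem (A :\: J))); last first.
  by move=> j; rewrite !inE.
by rewrite prodr_const cardsD (setIidPr sJA).
Qed.

(** Grouping the subsets by size yields [sigma] when [A] is everything and, up to the factor [n l],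
    [sigma_at] when [A] is the complement of [l]. *)
Lemma prod_subr_double (R : comPzRingType) (I : finType) (A : {set I}) (t : R)
    (n : I -> nat) :
  \prod_(j in A) (t - 2 * (n j)%:R)
    = \sum_(0 <= i < #|A|.+1)
        (- 2) ^+ i * (\sum_(J : {set I} | (#|J| == i) && (J \subset A))
                        \prod_(j in J) n j)%N%:R * t ^+ (#|A| - i).
Proof.
rewrite prod_addr_subset big_mkord.
rewrite (partition_big (fun J : {set I} => inord #|J| : 'I_#|A|.+1) predT) //=.
apply: eq_bigr => i _; rewrite natr_sum mulr_sumr mulr_suml.
apply: eq_big => J.
  rewrite andbC; case sJA: (J \subset A); rewrite ?andbF ?andbT //.
  by rewrite -val_eqE /= inordK // ltnS subset_leq_card.
case/andP=> sJA /eqP <-; rewrite inordK ?ltnS ?subset_leq_card // mulrC.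
congr (_ * _); under eq_bigr do rewrite -mulNr.
by rewrite big_split /= prodr_const natr_prod.
Qed.

Lemma prod_subr_sigma (R : comPzRingType) (s : nat) (n : 'I_s -> nat) (t : R) :
  \prod_j (t - 2 * (n j)%:R)
    = \sum_(0 <= i < s.+1) (- 2) ^+ i * (sigma n i)%:R * t ^+ (s - i).
Proof.
rewrite (eq_bigl (mem [set: 'I_s])); last by move=> j; rewrite /= inE.
rewrite prod_subr_double cardsT card_ord; apply: eq_big_nat => i _.
by congr (_ * _%:R * _); apply: eq_bigl => J; rewrite subsetT andbT.
Qed.

Lemma prod_subr_sigma_at (R : comPzRingType) (s : nat) (n : 'I_s -> nat)
    (l : 'I_s) (t : R) :
  (n l)%:R * \prod_(j | j != l) (t - 2 * (n j)%:R)
    = \sum_(1 <= i < s.+1) (- 2) ^+ i.-1 * (sigma_at n l i)%:R * t ^+ (s - i).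
Proof.
rewrite (eq_bigl (mem [set~ l])); last by move=> j; rewrite /= !inE.
rewrite prod_subr_double cardsC1 card_ord.
(* The index [l] excludes [s = 0]. Among [s.+1] indices, [s] differ from [l], and their subsets of
   size [i] give [sigma_at n l i.+1]. *)
case: s => [|s] in n l *; first by case: l.
rewrite big_add1 /= mulr_sumr; apply: eq_big_nat => i _.
rewrite subSS mulrA [_ * (_ * _)]mulrCA -natrM big_distrr /=.
congr (_ * _%:R * _); apply: eq_bigl => J; congr (_ && _).
by rewrite subsetC sub1set inE.
Qed.

(** After exchanging the sums, [q = m - i] turns the inner one into the binomial expansion of
    [('X + 1) ^+ (s - i)]. *)
Lemma sum_binomial_exprD1 (R : nzRingType) (s : nat) (c : nat -> R) :
  \sum_(0 <= m < s.+1) \sum_(0 <= i < m.+1)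
     (c i * 'C(s - i, m - i)%:R) *: 'X^(s - m)
  = \sum_(0 <= i < s.+1) c i *: ('X + 1) ^+ (s - i).
Proof.
under eq_big_nat => m /andP[_ lms] do rewrite (big_nat_widen _ _ s.+1) //.
rewrite (exchange_big_dep_nat xpredT) //=; apply: eq_big_nat => i /andP[_ lis].
rewrite -(big_nat_widenl _ _ _ xpredT) // -{1}[i]add0n big_addn subSn //.
rewrite exprDn_comm; last exact: commr1.
rewrite scaler_sumr -(big_mkord xpredT (fun q =>
  c i *: ('X^(s - i - q) * 1 ^+ q *+ 'C(s - i, q)))).
apply: eq_bigr => q _.
by rewrite addnK expr1n mulr1 -scaler_nat scalerA addnC subnDA.
Qed.

(** By injectivity of [n], each part has exactly one size index, so parts can be grouped by it. The
    operator is kept general to cover both sums and products. *)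
Lemma big_parts (R : Type) (idx : R) (op : Monoid.com_law idx) (T : finType)
    (P : {set {set T}}) (s : nat) (n r : 'I_s -> nat) (F : nat -> R) :
  injective n ->
  (forall B, B \in P -> exists i, #|B| = n i) ->
  (forall i, #|[set B in P | #|B| == n i]| = r i) ->
  \big[op/idx]_(B in P) F #|B|
    = \big[op/idx]_i iter (r i) (op (F (n i))) idx.
Proof.
move=> n_inj Pn Pr.
rewrite (eq_bigr (fun B : {set T} => \big[op/idx]_(i | #|B| == n i) F (n i))).
  rewrite (exchange_big_dep predT) //=; apply: eq_bigr => i _.
  by rewrite -Pr -big_const; apply: eq_bigl => B; rewrite inE.
move=> B /Pn[i nB]; rewrite (big_pred1 i) ?nB // => j.
by rewrite /= (inj_eq n_inj) eq_sym.
Qed.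

Lemma XaddC_sub_neq0 (R : nzRingType) (m : nat) :
  'X + 1 - 2 * m%:R != 0 :> {poly R}.
Proof.
have -> : 'X + 1 - 2 * m%:R = 'X + (1 - 2 * m%:R)%:P :> {poly R}.
  by rewrite rmorphB rmorphM /= !rmorph_nat addrA.
exact/monic_neq0/monicXaddC.
Qed.

(** The factors are exchanged with [A = t I] and [c = t], so that [U'] is [U] itself; this puts
    [t ^+ #|P|] on the left. *)
Lemma seidel_poly_parts (R : idomainType) (G : sgraph) (P : {set {set G}}) :
  partition P [set: G] ->
  (forall x y : G, edge x y = (pblock P x != pblock P y)) ->
  let t : {poly R} := 'X + 1 in
  seidel_poly R G * t ^+ #|P|
    = t ^+ #|G| * (\prod_(B in P) (t - 2 * #|B|%:R)
        + \sum_(B in P) #|B|%:R * \prod_(C in P | C != B) (t - 2 * #|C|%:R)).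
Proof.
move=> partP edgeP t.
have [/eqP coverP tiP _] := and3P partP.
have PP x : pblock P x \in P by rewrite pblock_mem // coverP inE.
(* [k] maps a vertex index to the index of its part. Selecting rows of the identity along [k] gives
   the incidence matrix [E], and [E *m M *m E^T] has entries [M (k i) (k j)]. *)
pose k (i : 'I_#|G|) : 'I_#|P| :=
  enum_rank_in (PP (enum_val i)) (pblock P (enum_val i)).
have kK i : enum_val (k i) = pblock P (enum_val i) by rewrite enum_rankK_in.
pose E : 'M[{poly R}]_(#|G|, #|P|) := rowsub k 1%:M.
pose M : 'M[{poly R}]_#|P| := const_mx 1 - 2%:M.
have charE : char_poly_mx (seidel_mx R G) = t%:M + (E *m M) *m E^T.
  apply/matrixP=> i j; rewrite -rowsubE -[_ *m _]trmxK trmx_mul trmxK -rowsubE.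
  rewrite !mxE edgeP -!kK (inj_eq enum_val_inj) !rmorphB rmorphM rmorphMn /=.
  rewrite /t; case: (i == j); case: (k i == k j); rewrite ?mulr1n ?mulr0n /=;
    ring.
pose d (b : 'I_#|P|) : {poly R} := #|enum_val b|%:R.
have sizeE : E^T *m E = diag_mx (\row_b d b).
  apply/matrixP=> a b; rewrite !mxE.
  under eq_bigr do rewrite !mxE.
  have [<-{b} | neq_ab] := eqVneq a b; last first.
    rewrite big1 // => i _; case: (k i =P a) => [->|]; last by rewrite mul0r.
    by rewrite (negbTE neq_ab) mulr0.
  rewrite mulr1n.
  under eq_bigr do rewrite -natrM mulnb andbb.
  rewrite -natr_sum; congr _%:R.
  under eq_bigr do rewrite -(inj_eq enum_val_inj) kK.
  rewrite -(big_enum_val (fun x : G => (pblock P x == enum_val a) : nat)) /=.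
  have blockE : [set x | pblock P x == enum_val a] = enum_val a.
    apply/setP=> x; rewrite inE.
    apply/eqP/idP => [<- | /(def_pblock tiP (enum_valP a))//].
    by rewrite mem_pblock coverP inE.
  by rewrite -[in RHS]blockE -big_mkcondr sum1_card cardsE.
rewrite /seidel_poly /char_poly charE.
rewrite (@det_addM_exchange _ _ _ _ _ (E *m M) _ t); last exact: mul_scalar_mx.
rewrite det_scalar mulmxA sizeE.
have -> : t%:M + diag_mx (\row_b d b) *m M
    = diag_mx (\row_b (t - 2 * d b))
      + (\col_b d b) *m (\row_b 1).
  apply/matrixP=> a b; rewrite mul_diag_mx !mxE big_ord1 !mxE.
  case: (a == b); rewrite ?mulr1n ?mulr0n; ring.
rewrite det_diag_addM_row; last first.
  by move=> b; apply: XaddC_sub_neq0.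
congr (_ * (_ + _)).
  by rewrite [RHS]big_enum_val.
rewrite [RHS]big_enum_val; apply: eq_bigr => b _; rewrite mul1r.
rewrite [in RHS]big_enum_val_cond; congr (_ * _); apply: eq_bigl => c.
by rewrite (inj_eq enum_val_inj).
Qed.

Theorem theorem2p9 (R : numFieldType) (s : nat) (n r : 'I_s -> nat)
  (s_gt0 : (0 < s)%N)
  (n_gt0 : forall i, (0 < n i)%N) (n_inj : injective n)
  (r_gt0 : forall i, (0 < r i)%N)
  (G : sgraph) (GK : complete_multipartite r n G) :
  seidel_poly R G =
    ('X + 1) ^+ (\sum_(i < s) r i * n i - \sum_(i < s) r i)%N
    * \prod_(i < s) ('X + 1 - (2 * (n i)%:R)%:P) ^+ (r i - 1)%N
    * ('X^s +
       \sum_(1 <= m < s.+1) \sum_(0 <= i < m.+1)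
         ((-1) ^ (i%:Z - 1) * 2 ^ (i%:Z - 1) * 'C(s - i, m - i)%:R
          * (\sum_(l < s) (r l)%:R * (sigma_at n l i)%:R - 2 * (sigma n i)%:R))
         *: 'X^(s - m)).
Proof.
case: GK => P [partP edgeP Pn Pr].
set t : {poly R} := 'X + 1.
pose a j : {poly R} := t - 2 * (n j)%:R.
have parts_sum (F : nat -> nat) :
    (\sum_(B in P) F #|B| = \sum_i r i * F (n i))%N.
  rewrite (big_parts _ _ n_inj Pn Pr); apply: eq_bigr => i _.
  by rewrite iter_addn_0 mulnC.
have cardP : #|P| = (\sum_i r i)%N.
  by rewrite -sum1_card (parts_sum (fun=> 1%N)); under eq_bigr do rewrite muln1.
have cardG : #|G| = (\sum_i r i * n i)%N.
  by rewrite -cardsT (card_partition partP) (parts_sum id).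
(* Hence the natural-number subtraction in the exponent of ['X + 1] is not truncated. *)
have le_cards : (\sum_i r i <= \sum_i r i * n i)%N.
  by apply: leq_sum => i _; rewrite leq_pmulr.
have t_neq0 : t != 0 by have := XaddC_sub_neq0 R 0; rewrite mulr0 subr0.
pose Q := \prod_i a i ^+ (r i - 1)%N.
have prod_parts : \prod_(B in P) (t - 2 * #|B|%:R) = Q * \prod_i a i.
  rewrite (big_parts _ (fun m => t - 2 * m%:R) n_inj Pn Pr) -big_split /=.
  by apply: eq_bigr => i _; rewrite iter_mulr_1 -exprSr subn1 prednK.
have prod_other_parts l B : B \in P -> #|B| = n l ->
    \prod_(C in P | C != B) (t - 2 * #|C|%:R) = Q * \prod_(j | j != l) a j.
  (* Restoring the missing factor, which is nonzero, reduces the claim to [prod_parts]. *)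
  move=> BP nB; apply: (mulfI (XaddC_sub_neq0 R (n l))).
  rewrite -/t -{1}nB -(bigD1 B) //= prod_parts (bigD1 l) //=.
  by rewrite mulrCA.
have sum_parts :
    \sum_(B in P) #|B|%:R * \prod_(C in P | C != B) (t - 2 * #|C|%:R)
      = Q * \sum_l (r l)%:R * ((n l)%:R * \prod_(j | j != l) a j).
  (* [big_parts] needs a summand depending on the size alone, hence [n j != m] in place of
     [j != l]. *)
  pose F m := m%:R * (Q * \prod_(j | n j != m) a j).
  have Fn l : F (n l) = (n l)%:R * (Q * \prod_(j | j != l) a j).
    by congr (_ * (_ * _)); apply: eq_bigl => j; rewrite (inj_eq n_inj).
  rewrite (eq_bigr (fun B : {set G} => F #|B|)); last first.
    move=> B BP; have [l nB] := Pn B BP.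
    by rewrite (prod_other_parts l) // nB Fn.
  rewrite (big_parts _ F n_inj Pn Pr) mulr_sumr; apply: eq_bigr => l _.
  by rewrite iter_addr_0 Fn -[LHS]mulr_natl; ring.
have -> : seidel_poly R G
    = t ^+ (\sum_i r i * n i - \sum_i r i)%N * Q
      * (\prod_i a i + \sum_l (r l)%:R * ((n l)%:R * \prod_(j | j != l) a j)).
  apply: (mulIf (expf_neq0 (\sum_i r i)%N t_neq0)).
  have := seidel_poly_parts R partP edgeP; rewrite -/t cardP cardG => ->.
  rewrite prod_parts sum_parts -mulrDr -[X in t ^+ X * _ = _](subnK le_cards).
  by rewrite exprD; ring.
congr (_ * _ * _).
  by apply: eq_bigr => i _; rewrite /a rmorphM /= !rmorph_nat.
(* The coefficient of [t ^+ (s - i)]; the binomials of the statement come only from expanding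
   [t = 'X + 1]. *)
pose c i : R := (-1) ^ (i%:Z - 1) * 2 ^ (i%:Z - 1)
  * (\sum_(l < s) (r l)%:R * (sigma_at n l i)%:R - 2 * (sigma n i)%:R).
have sigma0 : sigma n 0 = 1%N.
  by rewrite /sigma (big_pred1 set0) ?big_set0 // => J; rewrite cards_eq0.
(* At [i = 0] both integer exponents are -1, and [(-1)^-1 * 2^-1 * (-2) = 1]; so the [m = 0] term is
   the leading ['X^s]. *)
have c0 : c 0%N = 1.
  rewrite /c big1 => [|l _]; last by rewrite mulr0.
  by rewrite sigma0 sub0r mulr1 !exprN1 invrN1; field.
have cS i : c i.+1 = (- 2) ^+ i.+1 * (sigma n i.+1)%:R
    + (- 2) ^+ i * \sum_l (r l)%:R * (sigma_at n l i.+1)%:R.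
  have pred_int : i.+1%:Z - 1 = i by rewrite intS addrC addKr.
  by rewrite /c pred_int -!exprnP -exprMn mulN1r exprS; ring.
transitivity (\sum_(0 <= i < s.+1) c i *: t ^+ (s - i)); last first.
  rewrite -sum_binomial_exprD1 big_nat_recl //= big_nat1 c0 mul1r.
  rewrite bin0 subn0 scale1r big_add1; congr (_ + _).
  apply: eq_bigr => m _; apply: eq_bigr => i _; congr (_ *: _).
  by rewrite /c; ring.
rewrite prod_subr_sigma.
under [X in _ + X]eq_bigr => l _ do rewrite prod_subr_sigma_at mulr_sumr.
(* With the [t ^+ s] term split off, the [sigma] and [sigma_at] sums share the index [i.+1] and
   match [cS] termwise. *)
rewrite exchange_big big_add1 succnK !big_nat_recl // c0 sigma0 expr0 !mul1r.
rewrite scale1r -addrA -big_split; congr (_ + _); apply: eq_bigr => i _.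
rewrite cS -mul_polyC rmorphD !rmorphM /= !rmorphXn rmorphN !rmorph_nat mulrDl.
congr (_ + _); rewrite rmorph_sum mulr_sumr mulr_suml; apply: eq_bigr => l _.
by rewrite rmorphM /= !rmorph_nat; ring.
Qed.
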